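(* Let $1\le h\le n$ be integers. Consider the sum $$\sum_{l=0}^{n-1}\frac{(2th)^l}{l!}\sum_{j=0}^{h-1}(-1)^j\binom{h-1}{j}j^l\sum_{k=0}^{n-h}(-1)^{n-h-k}\binom{n-h}{k}Q_{n,h,l}(j,k,d),\qquad Q_{n,h,l}(j,k,d)=\sum_{i=0}^{n-l-1}q^{(n,h)}_{n-l-1-i}(j,k)\,d^i .$$ All the terms of this sum vanish except those corresponding to the monomials $k^{n-h}j^{h-1-l}$ in the constant term coefficient $q_{n-l-1}^{(n,h)}(j,k)$ of the polynomial $Q_{n,h,l}(j,k,\cdot)$. That is: for all $0\le l\le n-1$, $0\le i\le n-l-1$ and every monomial $j^ak^b$ occurring with nonzero coefficient in $q^{(n,h)}_{n-l-1-i}(j,k)$, one has $$\sum_{j=0}^{h-1}(-1)^j\binom{h-1}{j}j^{l+a}\sum_{k=0}^{n-h}(-1)^{n-h-k}\binom{n-h}{k}k^b=0$$ unless $i=0$, $l\le h-1$, $a=h-1-l$ and $b=n-h$.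
   Context: Fix $\lambda\in(0,1]$, $\theta\in(0,1)$. $(x)_N=x(x+1)\cdots(x+N-1)$ is the Pochhammer symbol, and $0^0=1$. For integers $1\le h\le n$ and $0\le l\le n-1$ define polynomials in $d$, with coefficients that are polynomials in the variables $j,k$: $$P_{n,h}(j,k,d)=(d-2j-1)(d+2h-2j-1)(d-j)_h((1-\theta)d-j)_h(\lambda\theta d+h-n-j+k)_n(\theta d+h-n-j+k)_n,$$ $$D_{n,h,l}(j,k,d)=\lambda\theta\, d^{l+1}(d+h-2j-1)(\theta d-j)_h(d-n+h-2j-1+k)_{n+h+1}.$$ $Q_{n,h,l}(j,k,d)$ is the quotient in the polynomial long division, with respect to the variable $d$, of $P_{n,h}(j,k,d)$ (degree $2n+2h+2$ in $d$) by $D_{n,h,l}(j,k,d)$ (degree $n+2h+l+3$ in $d$, leading coefficient $\lambda\theta\cdot\theta^h$). It has degree $n-l-1$ in $d$ and is written $Q_{n,h,l}(j,k,d)=\sum_{i=0}^{n-l-1}q^{(n,h)}_{n-l-1-i}(j,k)d^i$; the coefficients $q_i^{(n,h)}(j,k)$ are polynomials in $j,k$ and do not depend on $l$. *)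

(* Defs.v *)
From mathcomp Require Import all_boot all_order all_algebra.

Set Implicit Arguments.
Unset Strict Implicit.
Unset Printing Implicit Defensive.

Import Order.TTheory GRing.Theory Num.Theory.
Local Open Scope ring_scope.

Definition poch (A : nzRingType) (x : A) (N : nat) : A :=
  \prod_(i < N) (x + i%:R).

(* Polynomials in j, k, d are represented by nested univariate polynomials:
   d is the outermost variable, then j, and k is the innermost one. Hence an
   element of {poly polyJK R} is a polynomial in d with coefficients in R[j, k],
   and the coefficient of j^a k^b in c : polyJK R is c`_a`_b. *)
Notation polyJK R := {poly {poly R}}.
Notation polyJKD R := {poly polyJK R}.

Section Quotients.
Variables (R : realFieldType) (lambda theta : R).

Let d : polyJKD R := 'X.
Let j : polyJKD R := 'X%:P.
Let k : polyJKD R := 'X%:P%:P.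
Let lam : polyJKD R := lambda%:P%:P%:P.
Let th : polyJKD R := theta%:P%:P%:P.

Definition Ppol (n h : nat) : polyJKD R :=
  (d - 2%:R * j - 1) * (d + 2%:R * h%:R - 2%:R * j - 1)
  * poch (d - j) h * poch ((1 - th) * d - j) h
  * poch (lam * th * d + h%:R - n%:R - j + k) n
  * poch (th * d + h%:R - n%:R - j + k) n.

Definition Dpol (n h l : nat) : polyJKD R :=
  lam * th * d ^+ l.+1 * (d + h%:R - 2%:R * j - 1)
  * poch (th * d - j) h
  * poch (d - n%:R + h%:R - 2%:R * j - 1 + k) (n + h + 1).

(* The leading coefficient of Dpol in d is lambda * theta * theta ^+ h, a unit
   of R[j, k] when lambda and theta are nonzero, so that %/ is the Euclidean
   quotient in R[j, k][d] and not merely a pseudo-quotient. *)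
Definition Qpol (n h l : nat) : polyJKD R := Ppol n h %/ Dpol n h l.

Definition Qval (n h l : nat) (jv kv dv : R) : R :=
  (Qpol n h l).[dv%:P%:P].[jv%:P].[kv].

(* Coefficients of Q_{n,h,l} in d, numbered from the top degree n - l - 1
   downwards. With this numbering they do not depend on l; they are read off
   here from l = 0, and are meaningful for m <= n - 1 only. *)
Definition qcoef (n h m : nat) : polyJK R := (Qpol n h 0)`_(n - 1 - m).

End Quotients.

(* Main.v *)
Require Import Defs.
From mathcomp Require Import all_boot all_order all_algebra.
From mathcomp Require Import zify ring.

Set Implicit Arguments.
Unset Strict Implicit.
Unset Printing Implicit Defensive.

Import Order.TTheory GRing.Theory Num.Theory.
Local Open Scope ring_scope.

(** The proof weighs a bound on total degrees against the vanishing of high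
    order differences of powers.

    P has total degree at most 2n+2h+2 in (j, k, d), and D (for l = 0) has total
    degree at most n+2h+3; this is also its degree in d, with a leading
    coefficient that is a nonzero constant.  Long division by such a divisor
    respects total degrees (divp_filt), so that Q (for l = 0) has total degree
    at most n-1 (Qpol0_filt).  Replacing l = 0 by l multiplies the divisor by
    d^l, which only discards the l lowest coefficients of the quotient
    (Qpol_drop).  Hence a monomial j^a k^b of the coefficient of d^i in
    Q_{n,h,l} satisfies a + b + i + l <= n - 1.

    On the other hand the alternating binomial sum of order N kills the powers
    of exponent less than N (altsum_expr_eq0).  A monomial that survives both
    sums thus satisfies l + a >= h - 1 and b >= n - h, whence
    a + b + l >= n - 1, with equality only if b = n - h and l + a = h - 1:
    this forces i = 0, b = n - h and a = h - 1 - l (coef_moment_eq0). *)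

(** * Alternating binomial sums of powers *)

Section AlternatingSums.
Variable R : comNzRingType.

(** Absorbing a factor k into the binomial coefficient turns k^(b+1) at order N
    into (k+1)^b at order N-1, a combination of powers of exponent at most b. *)
Lemma altsum_expr_eq0 (N b : nat) : (b < N)%N ->
  \sum_(k < N.+1) (-1) ^+ k * 'C(N, k)%:R * k%:R ^+ b = 0 :> R.
Proof.
elim: N b => [//|N IHN] [_|b lt_bN].
  transitivity ((1 - 1) ^+ N.+1 : R); last by rewrite subrr expr0n.
  rewrite exprBn.
  by apply: eq_bigr => k _; rewrite !expr1n !mulr1 mulr_natr.
rewrite big_ord_recl expr0n mulr0 add0r.
transitivity (- (N.+1)%:R *
    \sum_(c < b.+1) 'C(b, c)%:R *
      (\sum_(k < N.+1) (-1) ^+ k * 'C(N, k)%:R * k%:R ^+ c) : R).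
  under [in RHS]eq_bigr => c _ do rewrite mulr_sumr.
  rewrite exchange_big mulr_sumr; apply: eq_bigr => k _; rewrite lift0 /=.
  have absorb : 'C(N.+1, k.+1)%:R * (k.+1)%:R = (N.+1)%:R * 'C(N, k)%:R :> R.
    by rewrite -!natrM mulnC -mul_bin_diag.
  have expand : (k.+1)%:R ^+ b = \sum_(c < b.+1) 'C(b, c)%:R * k%:R ^+ c :> R.
    rewrite -natr1 addrC exprDn; apply: eq_bigr => c _.
    by rewrite expr1n mul1r mulr_natl.
  rewrite !exprS mulrA -(mulrA (-1 * _)) absorb expand !mulr_sumr.
  by apply: eq_bigr => c _; ring.
rewrite big1 ?mulr0 // => c _.
by rewrite IHN ?mulr0 //; have := ltn_ord c; lia.
Qed.

Lemma altsum_rev_expr_eq0 (N b : nat) : (b < N)%N ->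
  \sum_(k < N.+1) (-1) ^+ (N - k) * 'C(N, k)%:R * k%:R ^+ b = 0 :> R.
Proof.
move=> lt_bN; transitivity ((-1) ^+ N *
    \sum_(k < N.+1) (-1) ^+ k * 'C(N, k)%:R * k%:R ^+ b : R).
  rewrite mulr_sumr; apply: eq_bigr => k _.
  have le_kN : (k <= N)%N by rewrite -ltnS.
  by rewrite !mulrA -signr_odd oddB // signr_addb !signr_odd.
by rewrite altsum_expr_eq0 ?mulr0.
Qed.

End AlternatingSums.

(** * Degree filtrations *)

(** F m stands for the elements of degree less than m, rather than at most m, so
    that F 0 contains only 0.  Truncated subtraction then gives the right bound
    F (m - i) on the coefficients of index i >= m, which have to vanish.  The product rule reads: degrees less
    than m and at most n add up to less than m + n. *)
Record filtration (A : nzRingType) (F : nat -> A -> Prop) : Prop := Filtration {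
  filt_eq0 : forall x, F 0%N x -> x = 0;
  filt0 : forall m, F m 0;
  filt1 : F 1%N 1;
  filt_leq : forall m n x, (m <= n)%N -> F m x -> F n x;
  filtB : forall m x y, F m x -> F m y -> F m (x - y);
  filtM : forall m n x y, F m x -> F n.+1 y -> F (m + n)%N (x * y) }.

(** Over R[Y] filtered by the degree in Y, this is the filtration of R[Y][X] by
    the total degree in X and Y. *)
Definition lift_filt (A : nzRingType) (F : nat -> A -> Prop)
    (m : nat) (p : {poly A}) : Prop :=
  forall i, F (m - i)%N p`_i.

Section FiltrationTheory.
Variables (A : nzRingType) (F : nat -> A -> Prop).
Hypothesis filtF : filtration F.

Lemma filtN m x : F m x -> F m (- x).
Proof. by move=> Fx; rewrite -sub0r; apply: (filtB filtF) => //; apply: filt0. Qed.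

Lemma filtD m x y : F m x -> F m y -> F m (x + y).
Proof.
by move=> Fx Fy; rewrite -[y]opprK; apply: (filtB filtF) => //; apply: filtN.
Qed.

Lemma filt_sum (I : Type) (r : seq I) (P : pred I) (E : I -> A) m :
  (forall i, P i -> F m (E i)) -> F m (\sum_(i <- r | P i) E i).
Proof.
by move=> FE; elim/big_ind: _ => //; [apply: filt0 | move=> x y; apply: filtD].
Qed.

Lemma filt_nat n : F 1%N n%:R.
Proof.
by elim: n => [|n IHn]; [apply: filt0 | rewrite -natr1; apply: filtD => //; apply: filt1].
Qed.

Lemma filtMS m n x y : F m.+1 x -> F n.+1 y -> F (m + n).+1 (x * y).
Proof. by rewrite -addSn; apply: (filtM filtF). Qed.

Lemma filt_poch x N : F 2%N x -> F N.+1 (poch x N).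
Proof.
move=> Fx; rewrite /poch; elim: N => [|N IHN].
  by rewrite big_ord0; apply: filt1.
rewrite big_ord_recr /= -[X in F X]addn1.
apply: (filtM filtF) => //; apply: filtD => //.
by apply: (filt_leq filtF) (filt_nat N).
Qed.

Lemma filt_polyC m c : F m c -> lift_filt F m c%:P.
Proof. by move=> Fc [|i]; rewrite coefC ?subn0 //; apply: filt0. Qed.

Lemma filt_polyX : lift_filt F 2%N 'X.
Proof.
by move=> i; rewrite coefX; case: eqP => [->|_]; [apply: filt1 | apply: filt0].
Qed.

Lemma lift_filt_size m p : lift_filt F m p -> (size p <= m)%N.
Proof.
move=> Fp; apply/leq_sizeP => i le_mi; apply: (filt_eq0 filtF).
by have := Fp i; rewrite (eqP le_mi).
Qed.

Lemma lift_filtration : filtration (lift_filt F).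
Proof.
split.
- by move=> p Fp; apply/polyP=> i; rewrite coef0; apply: (filt_eq0 filtF (Fp i)).
- by move=> m i; rewrite coef0; apply: filt0.
- by apply: filt_polyC; apply: filt1.
- move=> m n p le_mn Fp i; apply: (filt_leq filtF) (Fp i); exact: leq_sub2r.
- by move=> m p q Fp Fq i; rewrite coefB; apply: (filtB filtF).
move=> m n p q Fp Fq i; rewrite coefM; apply: filt_sum => u _.
have [lt_nu|le_un] := ltnP n (i - u).
  have := Fq (i - u)%N; rewrite (eqP lt_nu) => /(filt_eq0 filtF) ->.
  by rewrite mulr0; apply: filt0.
have [lt_mu|le_um] := ltnP m u.
  have := Fp u; rewrite (eqP (ltnW lt_mu)) => /(filt_eq0 filtF) ->.
  by rewrite mul0r; apply: filt0.
have := filtM filtF (Fp u) (_ : F (n - (i - u)).+1 _); rewrite -subSn // => Fpq.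
by apply: filt_leq (Fpq _ (Fq _)) => //; have := ltn_ord u; lia.
Qed.

End FiltrationTheory.

Lemma size_filtration (R : idomainType) :
  filtration (fun m (p : {poly R}) => (size p <= m)%N).
Proof.
split=> [p|m||m n p le_mn le_pm|m p q le_pm le_qm|m n p q le_pm le_qn].
- by rewrite leqn0 size_poly_eq0 => /eqP.
- by rewrite size_poly0.
- by rewrite size_poly1.
- exact: leq_trans le_mn.
- by apply: leq_trans (size_polyD _ _) _; rewrite size_polyN geq_max le_pm.
have [->|nz_p] := eqVneq p 0; first by rewrite mul0r size_poly0.
by apply: leq_trans (size_polyMleq _ _) _; lia.
Qed.

(** Comparing the coefficients of index e+i in P = Q D + (P mod D) expresses
    Q_i D_e through P and the Q_u with u > i, and D_e is invertible in degree 0;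
    the bound thus propagates from the top coefficient of Q downwards. *)
Lemma divp_filt (A : idomainType) (F : nat -> A -> Prop) (filtF : filtration F)
    (P D : {poly A}) (e s : nat) :
  lift_filt F (e + s)%N P -> lift_filt F e.+1 D -> size D = e.+1 ->
  lead_coef D \is a GRing.unit -> F 1%N (lead_coef D)^-1 ->
  lift_filt F s (P %/ D).
Proof.
move=> FP FD sizeD unitD FV; set Q := P %/ D.
have defP := Pdiv.IdomainUnit.divp_eq unitD P; rewrite -/Q in defP.
have szR : (size (P %% D)%R <= e)%N.
  by rewrite -ltnS -sizeD ltn_modp -size_poly_gt0 sizeD.
have leadD : lead_coef D = D`_e by rewrite lead_coefE sizeD.
have highD i : (e < i)%N -> D`_i = 0 by move=> lt_ei; rewrite nth_default ?sizeD.
suff claim t i : (size Q <= i + t)%N -> F (s - i)%N Q`_i.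
  by move=> i; apply: (claim (size Q)); rewrite leq_addl.
elim: t i => [|t IHt] i szQ.
  by rewrite nth_default -1?[i]addn0 //; apply: filt0.
have lt_i : (i < (e + i).+1)%N by lia.
have defQi : Q`_i * D`_e =
    P`_(e + i) - \sum_(u < (e + i).+1 | u != Ordinal lt_i) Q`_u * D`_(e + i - u).
  rewrite [in P`_ _]defP coefD coefM (bigD1 (Ordinal lt_i)) //= addnK.
  by rewrite [(P %% D)`_ _]nth_default ?(leq_trans szR) ?leq_addr // addr0 addrK.
have FQD : F (s - i)%N (Q`_i * D`_e).
  rewrite defQi; apply: (filtB filtF).
    by rewrite -(subnDl e); apply: FP.
  apply: (filt_sum filtF) => u; rewrite -val_eqE /= => ne_ui.
  (* For u < i the index e + i - u exceeds the degree of D. *)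
  have [lt_ui|le_iu] := ltnP u i.
    by rewrite highD ?mulr0; [apply: filt0 | lia].
  have FQu : F (s - u)%N Q`_u by apply: IHt; lia.
  have [le_su|lt_us] := leqP s u.
    rewrite (eqP le_su) in FQu; rewrite (filt_eq0 filtF FQu) mul0r.
    exact: filt0.
  have le_u : (u <= e + i)%N by rewrite -ltnS.
  have FDu : F (u - i).+1 D`_(e + i - u).
    by rewrite -[(u - i).+1](_ : e.+1 - (e + i - u) = _)%N; [apply: FD | lia].
  by apply: (filt_leq filtF) (filtM filtF FQu FDu); lia.
rewrite -[Q`_i](mulrK unitD) leadD -[(s - i)%N]addn0.
by apply: (filtM filtF) => //; rewrite -leadD.
Qed.

(** * Degrees and leading coefficients of products *)

Section LeadingCoefficients.
Variable A : idomainType.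
Implicit Types (p q : {poly A}) (a b c : A) (m n : nat).

(** Degree and leading coefficient are tracked together; over a domain both are
    multiplicative. *)
Definition has_lead p m c : Prop := size p = m.+1 /\ lead_coef p = c.

Lemma has_leadC c : c != 0 -> has_lead c%:P 0 c.
Proof. by move=> nz_c; split; rewrite ?size_polyC ?nz_c ?lead_coefC. Qed.

Lemma has_leadM p q m n a b :
  has_lead p m a -> has_lead q n b -> has_lead (p * q) (m + n) (a * b).
Proof.
move=> [szp <-] [szq <-]; split; last exact: lead_coefM.
by rewrite size_mul -?size_poly_gt0 ?szp ?szq // addSn addnS.
Qed.

Lemma has_lead_Xn m : has_lead 'X^m m 1.
Proof. by split; rewrite ?size_polyXn ?lead_coefXn. Qed.

Lemma has_lead_linear a c : a != 0 -> has_lead (a%:P * 'X + c%:P) 1 a.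
Proof.
move=> nz_a; split; first by rewrite size_MXaddC polyC_eq0 (negbTE nz_a) size_polyC nz_a.
by rewrite lead_coefDl ?size_mulX ?polyC_eq0 ?lead_coefM ?lead_coefC ?lead_coefX
     ?mulr1 // !size_polyC nz_a; case: (c != 0).
Qed.

Lemma has_lead_poch a c N : a != 0 -> has_lead (poch (a%:P * 'X + c%:P) N) N (a ^+ N).
Proof.
move=> nz_a; rewrite /poch; elim: N => [|N IHN].
  by rewrite big_ord0; apply: (@has_leadC 1); rewrite oner_eq0.
rewrite big_ord_recr /= -addn1 exprD; apply: has_leadM => //.
rewrite -[N%:R](rmorph_nat (@polyC A)) -addrA -polyCD; exact: has_lead_linear.
Qed.

End LeadingCoefficients.

(** * Moments of monomials *)

(* The filtration of R[j, k] by total degree. *)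
Local Notation jk_filt R :=
  (lift_filt (fun m (p : {poly R}) => (size p <= m)%N)).

Local Notation moment n h p b :=
  (\sum_(j < h) (-1) ^+ j * 'C(h - 1, j)%:R * j%:R ^+ p
     * (\sum_(k < (n - h).+1)
          (-1) ^+ (n - h - k) * 'C(n - h, k)%:R * k%:R ^+ b)).

Section Moments.
Variables (R : idomainType) (n h : nat).
Hypotheses (h_gt0 : (0 < h)%N) (h_le_n : (h <= n)%N).

Lemma moment_eq0 p b : (p < h - 1)%N || (b < n - h)%N -> moment n h p b = 0 :> R.
Proof.
rewrite -mulr_suml; case/orP=> [lt_p|lt_b].
  have := altsum_expr_eq0 R lt_p; rewrite (_ : (h - 1).+1 = h); last by lia.
  by move=> ->; rewrite mul0r.
by rewrite altsum_rev_expr_eq0 ?mulr0.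
Qed.

(** A monomial within the degree bound a + b < m <= n - l has a nonzero moment
    only if l + a >= h - 1 and b >= n - h, which leaves no room except for
    equality everywhere. *)
Lemma coef_moment_eq0 m l (c : polyJK R) a b : jk_filt R m c -> (m + l <= n)%N ->
  ~ [/\ (m + l = n)%N, (l < h)%N, a = (h - 1 - l)%N & b = (n - h)%N] ->
  c`_a`_b * moment n h (l + a) b = 0.
Proof.
move=> Fc le_mn not_exc.
have [lt_p|le_p] := ltnP (l + a) (h - 1).
  by rewrite moment_eq0 ?lt_p ?mulr0.
have [lt_b|le_b] := ltnP b (n - h).
  by rewrite moment_eq0 ?lt_b ?orbT ?mulr0.
rewrite nth_default ?mul0r //; apply: leq_trans (Fc a) _.
rewrite leqNgt; apply/negP=> lt_b; apply: not_exc.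
by split; lia.
Qed.

(** By linearity the double sum over j and k of a polynomial is the combination
    of the moments of its monomials; all of these vanish but one. *)
Lemma horner_moment m l (c : polyJK R) : jk_filt R m c -> (m + l <= n)%N ->
  \sum_(j < h) (-1) ^+ j * 'C(h - 1, j)%:R * j%:R ^+ l
    * (\sum_(k < (n - h).+1) (-1) ^+ (n - h - k) * 'C(n - h, k)%:R
         * c.[j%:R%:P].[k%:R])
  = if (l < h)%N then
      c`_(h - 1 - l)`_(n - h) * moment n h (l + (h - 1 - l)) (n - h)
    else 0.
Proof.
move=> Fc le_mn.
have szc : (size c <= n)%N.
  by apply: leq_trans (lift_filt_size (size_filtration R) Fc) _; lia.
have szca (a : nat) : (size (c`_a)%R <= n)%N by apply: leq_trans (Fc a) _; lia.
(* Ranging up to n, not m, keeps the exceptional exponents in the index set. *)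
transitivity (\sum_(ab : 'I_n * 'I_n) c`_ab.1`_ab.2 * moment n h (l + ab.1) ab.2).
  rewrite -(pair_big xpredT xpredT (fun a b : 'I_n => c`_a`_b * moment n h (l + a) b)) /=.
  under [RHS]eq_bigr => a _ do under eq_bigr => b _ do rewrite mulr_sumr.
  under [RHS]eq_bigr => a _ do rewrite exchange_big.
  rewrite [RHS]exchange_big; apply: eq_bigr => j _ /=.
  under [RHS]eq_bigr => a _ do under eq_bigr => b _ do rewrite !mulr_sumr.
  under [RHS]eq_bigr => a _ do rewrite exchange_big.
  rewrite [RHS]exchange_big mulr_sumr; apply: eq_bigr => k _ /=.
  rewrite (horner_coef_wide _ szc) horner_sum !mulr_sumr; apply: eq_bigr => a _.
  rewrite -polyC_exp hornerM hornerC (horner_coef_wide _ (szca a)).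
  rewrite mulr_suml !mulr_sumr; apply: eq_bigr => b _.
  by rewrite exprD; ring.
case: ltnP => [lt_lh|le_hl]; last first.
  apply: big1 => ab _; apply: (coef_moment_eq0 Fc le_mn) => -[_].
  by rewrite ltnNge le_hl.
have lt_a : (h - 1 - l < n)%N by lia.
have lt_b : (n - h < n)%N by lia.
rewrite (bigD1 (Ordinal lt_a, Ordinal lt_b)) //= [X in _ + X]big1 ?addr0 //.
move=> -[a b] /= ne_ab.
apply: (coef_moment_eq0 Fc le_mn) => -[_ _ def_a def_b].
by case/negP: ne_ab; apply/eqP; congr pair; apply: val_inj.
Qed.

End Moments.

(** * Total degree of the quotient *)

Section Quotient.
Variables (R : realFieldType) (lambda theta : R).
Variables (n h : nat).

Let filt_jk : filtration (jk_filt R) := lift_filtration (size_filtration R).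
Let filt_jkd : filtration (lift_filt (jk_filt R)) := lift_filtration filt_jk.

Local Notation P := (Ppol lambda theta n h).
Local Notation D := (Dpol lambda theta n h).

Let filt_const (c : R) : lift_filt (jk_filt R) 1 c%:P%:P%:P.
Proof.
apply: (filt_polyC filt_jk); apply: (filt_polyC (size_filtration R)).
by rewrite size_polyC; case: (c != 0).
Qed.

Let filt_d : lift_filt (jk_filt R) 2 'X. Proof. exact: (filt_polyX filt_jk). Qed.

Let filt_j : lift_filt (jk_filt R) 2 'X%:P.
Proof. by apply: (filt_polyC filt_jk); apply: (filt_polyX (size_filtration R)). Qed.

Let filt_k : lift_filt (jk_filt R) 2 'X%:P%:P.
Proof.
apply: (filt_polyC filt_jk); apply: (filt_polyC (size_filtration R)).
by rewrite size_polyX.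
Qed.

Let filt_nat1 m : lift_filt (jk_filt R) 1 m%:R.
Proof. exact: (filt_nat filt_jkd). Qed.

Let filt_nat2 m : lift_filt (jk_filt R) 2 m%:R.
Proof. by apply: (filt_leq filt_jkd) (filt_nat filt_jkd m). Qed.

Let filt_scale c x : lift_filt (jk_filt R) 1 c -> lift_filt (jk_filt R) 2 x ->
  lift_filt (jk_filt R) 2 (c * x).
Proof. by move=> Fc Fx; apply: (filtM filt_jkd (m := 1) (n := 1)). Qed.

Let filt_mul m1 m2 x y : lift_filt (jk_filt R) m1.+1 x -> lift_filt (jk_filt R) m2.+1 y ->
  lift_filt (jk_filt R) (m1 + m2).+1 (x * y).
Proof. exact: filtMS. Qed.

Ltac filt_linear :=
  match goal with
  | |- lift_filt _ _ (_ + _) => apply: (filtD filt_jkd); filt_linear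
  | |- lift_filt _ _ (- _) => apply: (filtN filt_jkd); filt_linear
  | |- lift_filt _ 2 (_ * _) => apply: filt_scale; filt_linear
  | |- lift_filt _ 1 (_ * _) =>
      apply: (filtM filt_jkd (m := 1) (n := 0)); filt_linear
  | |- lift_filt _ _ 'X => exact: filt_d
  | |- lift_filt _ _ 'X%:P => exact: filt_j
  | |- lift_filt _ _ 'X%:P%:P => exact: filt_k
  | |- lift_filt _ 1 _%:P => exact: filt_const
  | |- lift_filt _ 1 1 => exact: (filt_nat1 1)
  | |- lift_filt _ 1 _ => exact: filt_nat1
  | |- lift_filt _ 2 1 => exact: (filt_nat2 1)
  | |- lift_filt _ 2 _ => exact: filt_nat2
  end.

(** The bound is written as the degree n+2h+3 of the divisor plus n, the form in
    which the division consumes it. *)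
Lemma Ppol_filt : lift_filt (jk_filt R) (n + h.*2 + 3 + n) P.
Proof.
have -> : (n + h.*2 + 3 + n = (1 + 1 + h + h + n + n).+1)%N by lia.
have FX N x : lift_filt (jk_filt R) 2 x -> lift_filt (jk_filt R) N.+1 (poch x N).
  exact: filt_poch.
rewrite /Ppol; do 4 (apply: filt_mul; last by apply: FX; filt_linear).
by apply: filt_mul; filt_linear.
Qed.

Lemma Dpol_filt : lift_filt (jk_filt R) (n + h.*2 + 3).+1 (D 0).
Proof.
have -> : (n + h.*2 + 3 = 0 + 1 + 1 + h + (n + h + 1))%N by lia.
have FX N x : lift_filt (jk_filt R) 2 x -> lift_filt (jk_filt R) N.+1 (poch x N).
  exact: filt_poch.
rewrite /Dpol; do 2 (apply: filt_mul; last by apply: FX; filt_linear).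
apply: filt_mul; last by filt_linear.
by rewrite expr1; apply: filt_mul; filt_linear.
Qed.

Lemma qcoefE l i : (l + i < n)%N ->
  qcoef lambda theta n h (n - l - 1 - i) = (Qpol lambda theta n h 0)`_(l + i).
Proof. by move=> lt_n; rewrite /qcoef; congr (_`__); lia. Qed.

Hypotheses (nz_lambda : lambda != 0) (nz_theta : theta != 0).

Lemma Dpol_lead : has_lead (D 0) (n + h.*2 + 3) (lambda * theta * theta ^+ h)%:P%:P.
Proof.
have nz_th : theta%:P%:P != 0 :> polyJK R by rewrite !polyC_eq0.
have nz_1 : 1 != 0 :> polyJK R by rewrite oner_eq0.
have -> : (n + h.*2 + 3 = 0 + 1 + 1 + h + (n + h + 1))%N by lia.
have -> : (lambda * theta * theta ^+ h)%:P%:P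
    = (lambda * theta)%:P%:P * 1 * 1 * theta%:P%:P ^+ h * 1 ^+ (n + h + 1) :> polyJK R.
  by rewrite !mulr1 expr1n mulr1 !rmorphM /= !rmorphXn.
rewrite /Dpol; apply: has_leadM; last first.
  have -> : 'X - n%:R + h%:R - 2%:R * 'X%:P - 1 + 'X%:P%:P
      = 1%:P * 'X + (- n%:R + h%:R - 2%:R * 'X - 1 + 'X%:P)%:P :> polyJKD R.
    by rewrite !(rmorphD, rmorphN, rmorphM, rmorph1, rmorph_nat) /= mul1r; ring.
  exact: has_lead_poch.
apply: has_leadM; last first.
  have -> : theta%:P%:P%:P * 'X - 'X%:P = theta%:P%:P%:P * 'X + (- 'X)%:P :> polyJKD R.
    by rewrite rmorphN.
  exact: has_lead_poch.
apply: has_leadM; last first.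
  have -> : 'X + h%:R - 2%:R * 'X%:P - 1
      = 1%:P * 'X + (h%:R - 2%:R * 'X - 1)%:P :> polyJKD R.
    by rewrite !(rmorphD, rmorphN, rmorphM, rmorph1, rmorph_nat) /= mul1r; ring.
  exact: has_lead_linear.
apply: has_leadM; last exact: has_lead_Xn.
rewrite -!rmorphM; apply: has_leadC.
by rewrite !polyC_eq0 mulf_neq0.
Qed.

Lemma Dpol_unit : lead_coef (D 0) \is a GRing.unit.
Proof.
have [_ ->] := Dpol_lead; rewrite !rmorph_unit // unitfE.
by rewrite !mulf_neq0 ?expf_neq0.
Qed.

Lemma Qpol0_filt : lift_filt (jk_filt R) n (Qpol lambda theta n h 0).
Proof.
have [sizeD leadD] := Dpol_lead.
apply: (divp_filt filt_jk Ppol_filt Dpol_filt sizeD Dpol_unit).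
rewrite leadD -!rmorphV ?rmorph_unit ?unitfE ?mulf_neq0 ?expf_neq0 //=.
apply: (filt_polyC (size_filtration R)).
by rewrite size_polyC; case: (_ != 0).
Qed.

(** The divisor of index l is d^l times the divisor of index 0, and dividing by
    d^l drops the l lowest coefficients. *)
Lemma Qpol_drop l : Qpol lambda theta n h l = drop_poly l (Qpol lambda theta n h 0).
Proof.
have unitX : lead_coef ('X^l : polyJKD R) \is a GRing.unit.
  by rewrite lead_coefXn unitr1.
have -> : drop_poly l (Qpol lambda theta n h 0) = Qpol lambda theta n h 0 %/ 'X^l.
  apply: (Pdiv.IdomainUnit.divpP unitX (r := take_poly l (Qpol lambda theta n h 0))).
    by rewrite addrC poly_take_drop.
  by rewrite size_polyXn ltnS size_take_poly.
rewrite /Qpol (Pdiv.IdomainUnit.divp_divl _ unitX Dpol_unit); congr (_ %/ _).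
by rewrite /Dpol exprS expr1; ring.
Qed.

Lemma Qpol_coef l : (l < n)%N ->
  Qpol lambda theta n h l
  = \sum_(i < n - l) (qcoef lambda theta n h (n - l - 1 - i))%:P * 'X^i.
Proof.
move=> lt_ln; rewrite Qpol_drop.
transitivity (\poly_(i < n - l) (qcoef lambda theta n h (n - l - 1 - i))); last first.
  by rewrite poly_def; apply: eq_bigr => i _; rewrite mul_polyC.
apply/polyP => i; rewrite coef_drop_poly coef_poly addnC.
case: ltnP => [lt_i|le_i]; first by rewrite qcoefE //; lia.
by rewrite nth_default // (leq_trans (lift_filt_size filt_jk Qpol0_filt)) //; lia.
Qed.

Hypotheses (h_gt0 : (0 < h)%N) (h_le_n : (h <= n)%N).

Lemma Qval_coef l jv kv dv : (l < n)%N ->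
  Qval lambda theta n h l jv kv dv
  = \sum_(i < n - l) ((Qpol lambda theta n h 0)`_(l + i)).[jv%:P].[kv] * dv ^+ i.
Proof.
move=> lt_ln; rewrite /Qval (Qpol_coef lt_ln) !horner_sum; apply: eq_bigr => i _.
rewrite qcoefE; last by have := ltn_ord i; lia.
by rewrite hornerM hornerC hornerXn -!polyC_exp !hornerM !hornerC.
Qed.

(** The coefficients of positive powers of d have degree too small for their
    exceptional monomial to occur, so only the constant term contributes. *)
Lemma Qval_moment l dv : (l < n)%N ->
  \sum_(j < h) (-1) ^+ j * 'C(h - 1, j)%:R * j%:R ^+ l
    * (\sum_(k < (n - h).+1) (-1) ^+ (n - h - k) * 'C(n - h, k)%:R
         * Qval lambda theta n h l j%:R k%:R dv)
  = if (l < h)%N then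
      (qcoef lambda theta n h (n - l - 1))`_(h - 1 - l)`_(n - h)
        * moment n h (l + (h - 1 - l)) (n - h)
    else 0.
Proof.
move=> lt_ln; set Q := Qpol lambda theta n h 0.
have FQ i : jk_filt R (n - (l + i)) Q`_(l + i) by apply: Qpol0_filt.
transitivity (\sum_(i < n - l) dv ^+ i *
    (if (l < h)%N then
       Q`_(l + i)`_(h - 1 - l)`_(n - h) * moment n h (l + (h - 1 - l)) (n - h)
     else 0)).
  transitivity (\sum_(i < n - l) dv ^+ i *
      \sum_(j < h) (-1) ^+ j * 'C(h - 1, j)%:R * j%:R ^+ l
        * (\sum_(k < (n - h).+1) (-1) ^+ (n - h - k) * 'C(n - h, k)%:R
             * (Q`_(l + i)).[j%:R%:P].[k%:R])).
    under [RHS]eq_bigr => i _ do rewrite mulr_sumr.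
    rewrite [RHS]exchange_big; apply: eq_bigr => j _ /=.
    under [RHS]eq_bigr => i _ do rewrite !mulr_sumr.
    rewrite [RHS]exchange_big mulr_sumr; apply: eq_bigr => k _ /=.
    rewrite (Qval_coef _ _ _ lt_ln) !mulr_sumr; apply: eq_bigr => i _.
    by ring.
  apply: eq_bigr => i _; congr (_ * _); apply: (horner_moment h_gt0 h_le_n (FQ i)).
  by have := ltn_ord i; lia.
have gt0 : (0 < n - l)%N by lia.
rewrite (bigD1 (Ordinal gt0)) //= [X in _ + X]big1 ?addr0.
  by rewrite expr0 mul1r -qcoefE ?addn0 // subn0.
move=> i; rewrite -val_eqE /= => nz_i; case: ifP => [lt_lh|_]; last exact: mulr0.
have lt_i := ltn_ord i.
rewrite (coef_moment_eq0 h_gt0 h_le_n (FQ i)) ?mulr0 //; first by lia.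
by case=> eq_n _ _ _; lia.
Qed.

End Quotient.

Theorem proposition1 (R : realFieldType) (lambda theta : R)
    (lambda_gt0 : 0 < lambda) (lambda_le1 : lambda <= 1)
    (theta_gt0 : 0 < theta) (theta_lt1 : theta < 1)
    (n h : nat) (h_ge1 : (1 <= h)%N) (h_le_n : (h <= n)%N) :
  [/\ (* Q_{n,h,l} = \sum_i q_{n-l-1-i} d^i *)
      forall l : nat, (l < n)%N ->
        Qpol lambda theta n h l
        = \sum_(i < n - l) (qcoef lambda theta n h (n - l - 1 - i))%:P * 'X^i,
      (* a monomial j^a k^b of q_{n-l-1-i} contributes 0, with one exception *)
      forall l i a b : nat, (l <= n - 1)%N -> (i <= n - l - 1)%N ->
        (qcoef lambda theta n h (n - l - 1 - i))`_a`_b != 0 ->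
        ~ [/\ i = 0%N, (l <= h - 1)%N, a = (h - 1 - l)%N & b = (n - h)%N] ->
        \sum_(j < h) (-1) ^+ j * 'C(h - 1, j)%:R * j%:R ^+ (l + a)
          * (\sum_(k < (n - h).+1)
               (-1) ^+ (n - h - k) * 'C(n - h, k)%:R * k%:R ^+ b)
        = 0 :> R
    & (* hence only the exceptional monomials remain in the sum *)
      forall t d : R,
        \sum_(l < n) (2%:R * t * h%:R) ^+ l / l`!%:R
          * (\sum_(j < h) (-1) ^+ j * 'C(h - 1, j)%:R * j%:R ^+ l
            * (\sum_(k < (n - h).+1) (-1) ^+ (n - h - k) * 'C(n - h, k)%:R
              * Qval lambda theta n h l j%:R k%:R d))
        = \sum_(l < h) (2%:R * t * h%:R) ^+ l / l`!%:R
          * (qcoef lambda theta n h (n - l - 1))`_(h - 1 - l)`_(n - h)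
          * (\sum_(j < h) (-1) ^+ j * 'C(h - 1, j)%:R
               * j%:R ^+ (l + (h - 1 - l))
            * (\sum_(k < (n - h).+1) (-1) ^+ (n - h - k) * 'C(n - h, k)%:R
              * k%:R ^+ (n - h)))].

Proof.
have nz_lambda : lambda != 0 by rewrite gt_eqF.
have nz_theta : theta != 0 by rewrite gt_eqF.
split=> [l|l i a b le_l le_i|t d].
- exact: Qpol_coef.
- rewrite qcoefE; last by lia.
  move=> nz_c not_exc.
  have FQ := Qpol0_filt n h nz_lambda nz_theta (l + i)%N.
  have le_n : (n - (l + i) + l <= n)%N by lia.
  have not_exc' : ~ [/\ (n - (l + i) + l = n)%N, (l < h)%N, a = (h - 1 - l)%N
                      & b = (n - h)%N].
    by case=> eq_n lt_lh def_a def_b; apply: not_exc; split=> //; lia.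
  have /eqP := coef_moment_eq0 h_ge1 h_le_n FQ le_n not_exc'.
  by rewrite mulf_eq0 (negbTE nz_c) => /eqP.
rewrite [RHS](big_ord_widen n (fun l => (2%:R * t * h%:R) ^+ l / l`!%:R
          * (qcoef lambda theta n h (n - l - 1))`_(h - 1 - l)`_(n - h)
          * (\sum_(j < h) (-1) ^+ j * 'C(h - 1, j)%:R
               * j%:R ^+ (l + (h - 1 - l))
            * (\sum_(k < (n - h).+1) (-1) ^+ (n - h - k) * 'C(n - h, k)%:R
              * k%:R ^+ (n - h))) : R)) //.
rewrite [RHS]big_mkcond; apply: eq_bigr => l _ /=.
rewrite Qval_moment //; case: ifP => _; last exact: mulr0.
by rewrite mulrA.
Qed.
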